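(* Let $B$ be a nilpotent $n\times n$ matrix with $\mathrm{sh}(B)=(\lambda_1,\lambda_2)$, $\lambda_1\ge\lambda_2\ge1$, $n=\lambda_1+\lambda_2$. Choose integers $j,\ell$ with $0\le j\le\ell<\lambda_2$ and put $w=\lambda_1-\lambda_2+j+\ell$, assuming $w\ge1$. (a) If there is an integer $k$ with $\lambda_2\le kw<\lambda_1$, then $\big((2k+1)^{\lambda_1-kw},(2k)^{w+\lambda_2-\lambda_1},(2k-1)^{kw-\lambda_2}\big)\in\mathcal{P}(\mathcal{N}_B)$. (b) If there is an integer $k$ with $\lambda_1-\ell\le kw<\lambda_2-j$, then $\big((2k+2)^{\lambda_2-kw-j},(2k+1)^{w+j-\ell},(2k)^{kw+\ell-\lambda_2}\big)\in\mathcal{P}(\mathcal{N}_B)$. (c) If neither of the conditions in (a) and (b) holds, then $r(n,w)\in\mathcal{P}(\mathcal{N}_B)$.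
   Context: $\mathbb{F}$ is an algebraically closed field of characteristic $0$. For a nilpotent matrix $A$, $\mathrm{sh}(A)$ is the partition of $n$ given by the sizes of the Jordan blocks of its Jordan canonical form; $\mathcal{N}_B$ is the set of nilpotent $n\times n$ matrices commuting with $B$ and $\mathcal{P}(\mathcal{N}_B)=\{\mathrm{sh}(A):A\in\mathcal{N}_B\}$. The notation $(m_1^{r_1},m_2^{r_2},\ldots)$ denotes the partition with $r_i$ parts equal to $m_i$ (parts with exponent $0$ omitted). For $1\le t\le n$, $r(n,t)$ denotes the unique partition of $n$ with exactly $t$ parts whose largest and smallest parts differ by at most $1$, i.e. $r(n,t)=(\lceil n/t\rceil^{\rho},\lfloor n/t\rfloor^{t-\rho})$ with $\rho=n-t\lfloor n/t\rfloor$ (an ''almost rectangular partition''); when $t>n$ one interprets $r(n,t)=(1^n)$. *)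

(* Defs.v *)
From HB Require Import structures.
From mathcomp Require Import all_boot all_order all_algebra.
Set Implicit Arguments. Unset Strict Implicit. Unset Printing Implicit Defensive.
Import GRing.Theory.
Local Open Scope ring_scope.

Definition block_starts (p : seq nat) : seq nat :=
  [seq sumn (take i p) | i <- iota 0 (size p)].

(* The nilpotent Jordan matrix with blocks of sizes p (in this order):
   ones on the superdiagonal except at positions crossing a block boundary.
   Meaningful when sumn p = n. *)
Definition jordan_mx (F : fieldType) (n : nat) (p : seq nat) : 'M[F]_n :=
  \matrix_(i < n, j < n)
     (((j : nat) == (i : nat).+1) && ((j : nat) \notin block_starts p))%:R.

Definition is_partition (n : nat) (p : seq nat) : bool :=
  [&& sorted geq p, all (fun m => 0 < m)%N p & sumn p == n].

Definition mxpow (F : fieldType) (n : nat) (A : 'M[F]_n) (k : nat) : 'M[F]_n :=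
  iter k (mulmx A) 1%:M.

Definition nilpotent_mx (F : fieldType) (n : nat) (A : 'M[F]_n) : Prop :=
  exists k, mxpow A k = 0.

Definition shape_of (F : fieldType) (n : nat) (A : 'M[F]_n) (p : seq nat) : Prop :=
  is_partition n p /\
  exists P : 'M[F]_n, P \in unitmx /\ A = invmx P *m jordan_mx F n p *m P.

Definition in_PNB (F : fieldType) (n : nat) (B : 'M[F]_n) (p : seq nat) : Prop :=
  exists A : 'M[F]_n, [/\ nilpotent_mx A, A *m B = B *m A & shape_of A p].

Definition part3 (m1 r1 m2 r2 m3 r3 : nat) : seq nat :=
  nseq r1 m1 ++ nseq r2 m2 ++ nseq r3 m3.

Definition almost_rect (n t : nat) : seq nat :=
  (if n < t then nseq n 1
   else nseq (n %% t) (n %/ t).+1 ++ nseq (t - n %% t) (n %/ t))%N.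

(* Main.v *)
Require Import Defs.
From HB Require Import structures.
From mathcomp Require Import all_boot all_order all_algebra all_fingroup.
From mathcomp Require Import zify.

(** Identify F^n with the F[x]-module F[x]/(x^l1) e + F[x]/(x^l2) f on which B
    acts as x.  The endomorphism A : e |-> x^j f, f |-> x^c e with
    c = l1 - l2 + l satisfies A^2 = x^w and permutes the monomial basis up to
    zeros, so its Jordan type is read off the lengths of the w chains starting
    at x^i e (i < c) and x^i f (i < j).  This gives (a) and (b).  In (c) only
    the sum j + l matters, and the balanced choice of j and l makes the chain
    lengths almost equal. *)

Set Implicit Arguments. Unset Strict Implicit.
Import GRing.Theory.

(** * Jordan form read off from chains of basis vectors *)

Lemma mem_block_starts (p : seq nat) (t o : nat) :
  all (fun m => 0 < m) p -> o < nth 0 p t ->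
  (flatten_index p t o \in block_starts p) = (o == 0).
Proof.
move=> p_gt0 lt_o.
apply/mapP/eqP => [[i] | ->].
  rewrite mem_iota => /andP[_ lti] eqi.
  have lt0 : 0 < nth 0 p i by apply: (all_nthP 0 p_gt0).
  have := flatten_indexKr lt_o; rewrite eqi -[sumn _]addn0.
  by rewrite -/(flatten_index p i 0) flatten_indexKr.
exists t; last by rewrite /flatten_index addn0.
rewrite mem_iota /=; apply: contraTltn lt_o => le.
by rewrite nth_default.
Qed.

(** Block starts are the positions of offset 0, so a one on the superdiagonal never crosses from one
    block to the next. *)
Lemma jordan_mx_step (p : seq nat) (t o t' o' : nat) :
  all (fun m => 0 < m) p -> o < nth 0 p t -> o' < nth 0 p t' ->
  (flatten_index p t' o' == (flatten_index p t o).+1)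
    && (flatten_index p t' o' \notin block_starts p)
  = (t' == t) && (o' == o.+1).
Proof.
move=> p_gt0 lt_o lt_o'; rewrite mem_block_starts //.
apply/andP/andP => [[/eqP e o'0] | [/eqP-> /eqP->]]; last first.
  by rewrite /flatten_index addnS eqxx.
case: o' lt_o' e o'0 => // o' lt_o' e _.
have e' : flatten_index p t' o' = flatten_index p t o.
  by move: e; rewrite /flatten_index addnS => -[].
have lt2 := ltnW lt_o'.
have := flatten_indexKl lt2; have := flatten_indexKr lt2.
by rewrite e' flatten_indexKl // flatten_indexKr // => -> ->.
Qed.

(** [g t o] is the position of the [o]-th vector of chain [t]. Listing the basis chain by chain is a
    permutation, and its matrix conjugates [A] to Jordan form. *)
Lemma shape_of_chains (F : fieldType) (n : nat) (A : 'M[F]_n) (p : seq nat)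
    (g : nat -> nat -> nat) :
  is_partition n p ->
  (forall t o, o < nth 0 p t -> g t o < n) ->
  (forall t o t' o', o < nth 0 p t -> o' < nth 0 p t' ->
     g t o = g t' o' -> t = t' /\ o = o') ->
  (forall (x y : 'I_n) t o t' o', o < nth 0 p t -> o' < nth 0 p t' ->
     x = g t o :> nat -> y = g t' o' :> nat ->
     A x y = ((t' == t) && (o' == o.+1))%:R%R) ->
  shape_of A p.
Proof.
move=> p_part g_lt g_inj Ag; split=> //.
case/and3P: p_part => _ p_gt0 /eqP sum_p.
have off (r : 'I_n) : reshape_offset p r < nth 0 p (reshape_index p r).
  by rewrite reshape_offsetP ?sum_p.
pose f (r : 'I_n) : 'I_n := Ordinal (g_lt _ _ (off r)).
have f_inj : injective f.
  move=> r s /(congr1 val) /= /(g_inj _ _ _ _ (off r) (off s)) [et eo].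
  by apply: val_inj; rewrite /= -(reshape_indexK p r) et eo reshape_indexK.
(* Since [sumn p = n], [f] maps ['I_n] to itself, so injectivity alone shows that the chains cover
   the basis. *)
pose s := perm f_inj.
exists (perm_mx s); split; first exact: unitmx_perm.
apply: (can_inj (mulKmx (unitmx_perm F s))).
rewrite -mulmxA mulKVmx ?unitmx_perm // -row_permE.
rewrite -[s in RHS]invgK -col_permE.
apply/matrixP => i k; rewrite !mxE.
pose c := (s^-1)%g k; have ->: k = s c by rewrite permKV.
rewrite permK !permE (Ag _ _ _ _ _ _ (off i) (off c)) //.
by rewrite -(jordan_mx_step (p := p)) // !reshape_indexK.
Qed.

(** * Reduction to [B] in Jordan form *)

Lemma mxpow_conj (F : fieldType) (n : nat) (P A : 'M[F]_n) (k : nat) :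
  P \in unitmx ->
  mxpow (invmx P *m A *m P)%R k = (invmx P *m mxpow A k *m P)%R.
Proof.
move=> uP; elim: k => [|k IH]; first by rewrite /= mulmx1 mulVmx.
by rewrite /= IH !mulmxA mulmxK.
Qed.

Lemma in_PNB_conj (F : fieldType) (n : nat) (P A B : 'M[F]_n) (p : seq nat) :
  P \in unitmx -> nilpotent_mx A -> (A *m B)%R = (B *m A)%R -> shape_of A p ->
  in_PNB (invmx P *m B *m P)%R p.
Proof.
move=> uP [k Ak] AB [p_part [Q [uQ AQ]]].
exists (invmx P *m A *m P)%R; split.
- by exists k; rewrite mxpow_conj // Ak mulmx0 mul0mx.
- by rewrite !mulmxA mulmxK // mulmxK // -!(mulmxA (invmx P)) AB.
- have uQP : (Q *m P)%R \in unitmx by rewrite unitmx_mul uQ.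
  split=> //; exists (Q *m P)%R; split=> //.
  apply: (can_inj (mulKmx uQP)).
  by rewrite -(mulmxA (invmx (Q *m P)%R)) mulKVmx // AQ !mulmxA mulmxK // mulmxV // mul1mx.
Qed.

(** * Matrices of maps on monomials *)

(* [(false, i)] stands for x^i e and [(true, i)] for x^i f. *)
Definition in_block (l1 l2 : nat) (v : bool * nat) : bool :=
  v.2 < (if v.1 then l2 else l1).

Definition block_pos (l1 x : nat) : bool * nat :=
  if x < l1 then (false, x) else (true, x - l1).

Definition pos_block (l1 : nat) (v : bool * nat) : nat :=
  if v.1 then l1 + v.2 else v.2.

(** Matrices act on row vectors. If [f] leaves the blocks the row is zero, which encodes x^l1 e = 0
    and x^l2 f = 0. *)
Definition fun_mx (F : fieldType) (l1 l2 : nat)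
    (f : bool * nat -> bool * nat) : 'M[F]_(l1 + l2) :=
  (\matrix_(x, y) (block_pos l1 y == f (block_pos l1 x))%:R)%R.

Lemma pos_block_lt l1 l2 v : in_block l1 l2 v -> pos_block l1 v < l1 + l2.
Proof. by case: v => [[] i]; rewrite /in_block /pos_block /=; lia. Qed.

Lemma pos_blockK l1 l2 v : in_block l1 l2 v -> block_pos l1 (pos_block l1 v) = v.
Proof.
case: v => [[] i]; rewrite /in_block /pos_block /block_pos /= => lti.
  by rewrite ltnNge leq_addr /= addKn.
by rewrite lti.
Qed.

Lemma block_posK l1 : cancel (block_pos l1) (pos_block l1).
Proof.
move=> x; rewrite /block_pos; case: ltnP => //= le; rewrite /pos_block /=; lia.
Qed.

Lemma block_pos_in l1 l2 (x : 'I_(l1 + l2)) : in_block l1 l2 (block_pos l1 x).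
Proof.
by case: x => x ltx; rewrite /block_pos /in_block /=; case: (ltnP x l1) => //=; lia.
Qed.

(** The hypothesis keeps [g] from bringing a vanished monomial back into a block, where [g \o f]
    would give a one but the product a zero. *)
Lemma fun_mx_comp (F : fieldType) l1 l2 f g :
  (forall v, in_block l1 l2 (g v) -> in_block l1 l2 v) ->
  (fun_mx F l1 l2 f *m fun_mx F l1 l2 g)%R = fun_mx F l1 l2 (g \o f).
Proof.
move=> g_in; apply/matrixP=> x z; rewrite !mxE /=.
under eq_bigr => y _ do rewrite !mxE.
have [inf | ninf] := boolP (in_block l1 l2 (f (block_pos l1 x))).
  have fK := pos_blockK inf.
  rewrite (bigD1 (Ordinal (pos_block_lt inf))) //= fK eqxx mul1r big1 ?addr0 //.
  move=> y /negP neq; case: eqP => [e|]; last by rewrite mul0r.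
  by case: neq; apply/eqP/val_inj; rewrite /= -e block_posK.
rewrite big1 => [|y _].
  case: eqP => // e; case/negP: ninf; apply: g_in; rewrite -e.
  exact: block_pos_in.
case: eqP => [e|]; last by rewrite mul0r.
by case/negP: ninf; rewrite -e block_pos_in.
Qed.

Lemma mxpow_fun_mx (F : fieldType) l1 l2 f k :
  (forall v, in_block l1 l2 (f v) -> in_block l1 l2 v) ->
  mxpow (fun_mx F l1 l2 f) k = fun_mx F l1 l2 (iter k f).
Proof.
move=> f_in; elim: k => [|k IH] /=.
  apply/matrixP=> x y; rewrite !mxE /= (can_eq (block_posK l1)).
  by rewrite -val_eqE eq_sym.
rewrite IH fun_mx_comp; last first.
  by elim: k {IH} => //= k IH v /f_in/IH.
by apply/matrixP=> x y; rewrite !mxE /= -iterSr.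
Qed.

Lemma jordan_mx_shift (F : fieldType) l1 l2 :
  0 < l2 ->
  jordan_mx F (l1 + l2) [:: l1; l2] =
  fun_mx F l1 l2 (fun v => (v.1, v.2.+1)).
Proof.
move=> l2_gt0; apply/matrixP=> x y; rewrite !mxE; congr (_%:R)%R.
rewrite /block_starts /= !inE addn0 /block_pos.
case: ltnP => hy; case: ltnP => hx; rewrite xpair_eqE /=; lia.
Qed.

(** * The endomorphism A and its chains *)

(** Exponents are not truncated here, which makes the map injective; [in_block] decides what
    vanishes. *)
Definition swap (j c : nat) (v : bool * nat) : bool * nat :=
  if v.1 then (false, v.2 + c) else (true, v.2 + j).

(** The two inequalities say that A is well defined: the images x^(l1+j) f of x^l1 e and x^(l2+c) e
    of x^l2 f must vanish. *)
Lemma swap_in l1 l2 j c : l1 <= l2 + c -> l2 <= l1 + j ->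
  forall v, in_block l1 l2 (swap j c v) -> in_block l1 l2 v.
Proof. by move=> h1 h2 [[] i]; rewrite /in_block /=; lia. Qed.

Lemma swap_inj j c : injective (swap j c).
Proof. by move=> [[] i] [[] i'] //= [] e; congr pair; lia. Qed.

(** These are the j + c pairs outside the image of [swap j c]. *)
Definition start (j c : nat) (v : bool * nat) : bool :=
  v.2 < (if v.1 then j else c).

Lemma startN_swap j c v : ~~ start j c (swap j c v).
Proof. by case: v => [[] i]; rewrite /start /=; lia. Qed.

(** Cancel common steps by injectivity; a start is not an image, so both counts run out together.
    Hence distinct chains are disjoint. *)
Lemma iter_swap_inj j c s s' o o' : start j c s -> start j c s' ->
  iter o (swap j c) s = iter o' (swap j c) s' -> s = s' /\ o = o'.
Proof.
move=> hs hs'; elim: o o' => [|o IH] [|o'] //= e.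
- by move: hs (startN_swap j c (iter o' (swap j c) s')); rewrite e => ->.
- by move: hs' (startN_swap j c (iter o (swap j c) s)); rewrite -e => ->.
- by case: (IH _ (@swap_inj j c _ _ e)) => -> ->.
Qed.

Lemma iter_swap_double j c k v :
  iter (2 * k) (swap j c) v = (v.1, v.2 + k * (j + c)).
Proof.
elim: k => [|k IH]; first by case: v => *; rewrite muln0 /= addn0.
rewrite mulnS /= IH /swap; case: v {IH} => [[] i] /=; congr pair; lia.
Qed.

Lemma iter_swap_le l1 l2 j c v o o' : l1 <= l2 + c -> l2 <= l1 + j -> o <= o' ->
  in_block l1 l2 (iter o' (swap j c) v) -> in_block l1 l2 (iter o (swap j c) v).
Proof.
move=> h1 h2 /subnK <-; rewrite iterD.
by elim: (o' - o) => //= k IH /(swap_in h1 h2).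
Qed.

Lemma nilpotent_swap (F : fieldType) l1 l2 j c :
  l1 <= l2 + c -> l2 <= l1 + j -> 0 < j + c ->
  nilpotent_mx (fun_mx F l1 l2 (swap j c)).
Proof.
(* This many steps raise every exponent by (l1 + l2)(j + c) >= l1 + l2, past the end of either
   block. *)
move=> h1 h2 w_gt0; exists (2 * (l1 + l2)); rewrite mxpow_fun_mx; last exact: swap_in.
apply/matrixP=> x y; rewrite !mxE; case: eqP => // e.
have := block_pos_in y; rewrite e iter_swap_double /in_block /=.
by case: ifP => _; have := leq_pmulr (l1 + l2) w_gt0; lia.
Qed.

Lemma swap_jordan_comm (F : fieldType) l1 l2 j c :
  l1 <= l2 + c -> l2 <= l1 + j -> 0 < l2 ->
  (fun_mx F l1 l2 (swap j c) *m jordan_mx F (l1 + l2) [:: l1; l2])%R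
  = (jordan_mx F (l1 + l2) [:: l1; l2] *m fun_mx F l1 l2 (swap j c))%R.
Proof.
move=> h1 h2 l2_gt0; rewrite jordan_mx_shift // !fun_mx_comp //.
- by apply/matrixP=> x y; rewrite !mxE; case: (block_pos l1 x) => [[] i].
- exact: swap_in.
- by move=> [[] i]; rewrite /in_block /=; lia.
Qed.

(* Each pair [(s, m)] of [Q] is a chain s, A s, ..., A^(m-1) s of basis vectors.
   That the chains exhaust the basis is forced by [sumn (unzip2 Q) = l1 + l2]. *)
Lemma shape_of_swap (F : fieldType) l1 l2 j c (Q : seq ((bool * nat) * nat)) :
  l1 <= l2 + c -> l2 <= l1 + j -> uniq (unzip1 Q) ->
  (forall s m, (s, m) \in Q ->
     start j c s /\ in_block l1 l2 (iter m.-1 (swap j c) s)) ->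
  is_partition (l1 + l2) (unzip2 Q) ->
  shape_of (fun_mx F l1 l2 (swap j c)) (unzip2 Q).
Proof.
move=> h1 h2 uQ hQ p_part; set p := unzip2 Q.
pose S t := nth (false, 0) (unzip1 Q) t.
have lt_size t o : o < nth 0 p t -> t < size Q.
  by apply: contraTltn => le; rewrite nth_default ?size_map.
have chain t o : o < nth 0 p t ->
    start j c (S t) /\ in_block l1 l2 (iter o (swap j c) (S t)).
  move=> lt; have tQ := lt_size _ _ lt.
  have /hQ [st inb] : (S t, nth 0 p t) \in Q.
    have -> : (S t, nth 0 p t) = nth ((false, 0), 0) Q t.
      by rewrite /S /p (nth_map ((false, 0), 0)) // (nth_map ((false, 0), 0)) //; case: nth.
    exact: mem_nth.
  by split=> //; apply: iter_swap_le inb => //; lia.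
have S_inj t o t' o' : o < nth 0 p t -> o' < nth 0 p t' -> S t = S t' -> t = t'.
  move=> /lt_size lt /lt_size lt' /eqP.
  by rewrite nth_uniq ?size_map // => /eqP.
apply: (@shape_of_chains _ _ _ _ (fun t o => pos_block l1 (iter o (swap j c) (S t)))) => //.
- by move=> t o /chain[_ /pos_block_lt].
- move=> t o t' o' lt lt'; have [st inb] := chain _ _ lt.
  have [st' inb'] := chain _ _ lt' => /(congr1 (block_pos l1)).
  rewrite (pos_blockK inb) (pos_blockK inb') => /iter_swap_inj [] // eS ->.
  by split=> //; apply: S_inj lt lt' eS.
- move=> x y t o t' o' lt lt' ex ey; have [st inb] := chain _ _ lt.
  have [st' inb'] := chain _ _ lt'.
  rewrite mxE ex ey (pos_blockK inb) (pos_blockK inb') -iterS; congr ((nat_of_bool _)%:R)%R.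
  apply/eqP/andP => [/iter_swap_inj [] // eS -> | [/eqP-> /eqP->] //].
  by rewrite (S_inj _ _ _ _ lt' lt eS) !eqxx.
Qed.

(** * Chains of three consecutive lengths *)

Definition seg (b : bool) (a a' : nat) : seq (bool * nat) :=
  [seq (b, i) | i <- index_iota a a'].

Lemma count_seg_cat P b a1 a2 a3 : a1 <= a2 -> a2 <= a3 ->
  count P (seg b a1 a3) = count P (seg b a1 a2) + count P (seg b a2 a3).
Proof.
move=> h1 h2; rewrite -count_cat /seg -map_cat /index_iota.
have -> : a3 - a1 = (a2 - a1) + (a3 - a2) by lia.
by rewrite iotaD subnKC.
Qed.

Definition label (m : nat) (s : seq (bool * nat)) := [seq (v, m) | v <- s].

Lemma unzip1_label m s : unzip1 (label m s) = s.
Proof. by rewrite /unzip1 -map_comp map_id_in. Qed.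

Lemma unzip2_label m s : unzip2 (label m s) = nseq (size s) m.
Proof. by elim: s => //= x s ->. Qed.

Lemma sorted_part3 m1 r1 m2 r2 m3 r3 : m3 <= m2 -> m2 <= m1 ->
  sorted geq (part3 m1 r1 m2 r2 m3 r3).
Proof.
move=> h1 h2; have tr : transitive geq by move=> a b c /= ab bc; apply: leq_trans bc ab.
rewrite sorted_pairwise // /part3 !pairwise_cat.
have pn m r : pairwise geq (nseq r m).
  by elim: r => //= r ->; rewrite andbT all_nseq /= leqnn orbT.
rewrite !pn /allrel !all_nseq /= !all_cat !all_nseq /=; lia.
Qed.

(* Chains from x^i e have length m+1, m, m-1 for i in [0, a1), [a1, a2), [a2, c);
   chains from x^i f likewise for i in [0, b1), [b1, b2), [b2, j). *)
Lemma in_PNB_swap (F : fieldType) l1 l2 j c m a1 a2 b1 b2 r1 r2 r3 (B : 'M[F]_(l1 + l2)) :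
  0 < l2 -> l1 <= l2 + c -> l2 <= l1 + j -> 0 < j + c -> shape_of B [:: l1; l2] ->
  a1 <= a2 -> a2 <= c -> b1 <= b2 -> b2 <= j ->
  0 < m -> (1 < m) || (a2 + b2 == c + j) ->
  (forall i, i < a1 -> in_block l1 l2 (iter m (swap j c) (false, i))) ->
  (forall i, i < a2 -> in_block l1 l2 (iter m.-1 (swap j c) (false, i))) ->
  (forall i, a2 <= i -> i < c -> in_block l1 l2 (iter m.-2 (swap j c) (false, i))) ->
  (forall i, i < b1 -> in_block l1 l2 (iter m (swap j c) (true, i))) ->
  (forall i, i < b2 -> in_block l1 l2 (iter m.-1 (swap j c) (true, i))) ->
  (forall i, b2 <= i -> i < j -> in_block l1 l2 (iter m.-2 (swap j c) (true, i))) ->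
  r1 = a1 + b1 -> r1 + r2 = a2 + b2 -> r1 + r2 + r3 = c + j ->
  m * (j + c) + r1 = l1 + l2 + r3 ->
  in_PNB B (part3 m.+1 r1 m r2 m.-1 r3).
Proof.
move=> l2_gt0 h1 h2 w_gt0 [_ [P [uP ->]]] a12 a2c b12 b2j m_gt0 m_gt1.
move=> e1 e2 e3 f1 f2 f3 eq1 eq2 eq3 eq_sum.
apply: in_PNB_conj uP (nilpotent_swap F h1 h2 w_gt0)
  (swap_jordan_comm F h1 h2 l2_gt0) _.
(* Grouping the starts by decreasing chain length makes [unzip2 Q] the required partition. *)
pose Q := label m.+1 (seg false 0 a1 ++ seg true 0 b1)
  ++ label m (seg false a1 a2 ++ seg true b1 b2)
  ++ label m.-1 (seg false a2 c ++ seg true b2 j).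
have eQ : part3 m.+1 r1 m r2 m.-1 r3 = unzip2 Q.
  rewrite /Q /unzip2 !map_cat -!/(unzip2 _) !unzip2_label !size_cat !size_map.
  rewrite !size_iota /part3; congr (nseq _ _ ++ (nseq _ _ ++ nseq _ _)); lia.
rewrite eQ; apply: shape_of_swap => //.
- have -> : uniq (unzip1 Q) = uniq (seg false 0 c ++ seg true 0 j).
    apply: perm_uniq; apply/seq.permP => p.
    rewrite /Q /unzip1 !map_cat -!/(unzip1 _) !unzip1_label !count_cat.
    rewrite (@count_seg_cat p false 0 a1 c) ?(leq_trans a12) //.
    rewrite (@count_seg_cat p false a1 a2 c) //.
    rewrite (@count_seg_cat p true 0 b1 j) ?(leq_trans b12) //.
    rewrite (@count_seg_cat p true b1 b2 j) //.
    by rewrite (addnACA (count p (seg false a1 a2))) addnACA.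
  rewrite cat_uniq !map_inj_uniq ?iota_uniq ?andbT //=; try by move=> x y [].
  by apply/hasPn => _ /mapP[i _ ->]; apply/mapP => -[].
- move=> s k; rewrite /Q !mem_cat /label !map_cat !mem_cat.
  by case/or3P=> /orP[] /mapP[_ /mapP[i + ->] [-> ->]];
     rewrite mem_index_iota => /andP[lo hi]; (split; first by rewrite /start /=; lia);
     [apply: e1 | apply: f1 | apply: e2 | apply: f2 | apply: e3 | apply: f3].
- rewrite -eQ /is_partition sorted_part3 ?leq_pred //=.
  rewrite /part3 !all_cat !all_nseq !sumn_cat !sumn_nseq /=; apply/andP; split.
    (* For m = 1 the third size is 0, and then a2 + b2 = c + j forces r3 = 0. *)
    by rewrite m_gt0 !orbT /=; case/orP: m_gt1 => ?; lia.
  (* The parts sum to m(r1 + r2 + r3) + r1 - r3. *)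
  by apply/eqP; move: eq_sum; rewrite [j + c]addnC -eq3; case: (m) m_gt0 => //= m' _; nia.
Qed.

(** * Chain lengths in the three cases *)

Lemma in_block_even l1 l2 j c k v :
  in_block l1 l2 (iter (2 * k) (swap j c) v)
  = (v.2 + k * (j + c) < (if v.1 then l2 else l1)).
Proof. by rewrite iter_swap_double. Qed.

Lemma in_block_odd l1 l2 j c k v :
  in_block l1 l2 (iter (2 * k).+1 (swap j c) v)
  = (v.2 + k * (j + c) + (if v.1 then c else j) < (if v.1 then l1 else l2)).
Proof. by rewrite iterS iter_swap_double; case: v => [[] i]. Qed.

Definition in_block_iter := (in_block_even, in_block_odd).

(** The value r = w, not a remainder, is allowed: all parts are then m + 1. The size [x] is free
    because its exponent is 0, so it can match [m.-1] in [in_PNB_swap]. *)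
Lemma almost_rect_part3 m w r x :
  0 < w -> w <= m * w + r -> r <= w ->
  almost_rect (m * w + r) w = part3 m.+1 r m (w - r) x 0.
Proof.
move=> w_gt0 le_wn; rewrite /almost_rect ltnNge le_wn /= /part3 cats0.
rewrite leq_eqVlt => /predU1P[-> | lt_rw].
  by rewrite addnC -mulSn modnMl mulnK // subn0 subnn cats0.
by rewrite modnMDl divnMDl // modn_small // divn_small // addn0.
Qed.

Unset Implicit Arguments.

Theorem theorem3p6 (F : closedFieldType) (hF : [pchar F]%R =i pred0)
  (n l1 l2 j l : nat) (B : 'M[F]_n)
  (hl : (l2 <= l1)%N) (hl2 : (1 <= l2)%N) (hn : n = (l1 + l2)%N)
  (hB : nilpotent_mx B) (hsh : shape_of B [:: l1; l2])
  (hj : (j <= l)%N) (hll : (l < l2)%N)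
  (hw : (1 <= l1 - l2 + j + l)%N) :
  let w := (l1 - l2 + j + l)%N in
  [/\ forall k : nat, (l2 <= k * w)%N -> (k * w < l1)%N ->
        in_PNB B (part3 (2 * k).+1 (l1 - k * w) (2 * k) (w + l2 - l1)
                        (2 * k - 1) (k * w - l2)),
      forall k : nat, (l1 - l <= k * w)%N -> (k * w < l2 - j)%N ->
        in_PNB B (part3 (2 * k + 2) (l2 - k * w - j) (2 * k).+1 (w + j - l)
                        (2 * k) (k * w + l - l2))
    & (~ exists k : nat, (l2 <= k * w)%N && (k * w < l1)%N) ->
      (~ exists k : nat, (l1 - l <= k * w)%N && (k * w < l2 - j)%N) ->
      in_PNB B (almost_rect n w)].
Proof.
subst n; move=> w; split.
- case=> [|k]; first by rewrite mul0n; lia.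
  rewrite mulSn subn1 => K1 K2; pose c := l1 - l2 + l.
  have jc : j + c = w by rewrite /w /c; lia.
  have m1 : (2 * k.+1).-1 = (2 * k).+1 by lia.
  (* With K = k + 1 the index of (a), 2K steps take x^i e to x^(i+Kw) e, nonzero for i < l1 - Kw,
     and 2K - 1 steps reach f, nonzero for i < l1 - Kw + l. All j chains from f have length 2K,
     since l2 <= Kw < l1. *)
  apply: (@in_PNB_swap _ l1 l2 j c (2 * k.+1) (l1 - (w + k * w))
    (l1 - (w + k * w) + l) 0 j) hsh _ _ _ _ _ _ _ _ _ _ _ _ _ _ _ _;
    try (move=> i); rewrite ?m1 ?succnK ?in_block_iter ?jc -?mulnA ?(mulSn k) /=; lia.
- case=> [|k]; first by rewrite mul0n; lia.
  rewrite mulSn addn2 => K1 K2; pose c := l1 - l2 + l.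
  have jc : j + c = w by rewrite /w /c; lia.
  have m2 : (2 * k.+1).+1.-2 = (2 * k).+1 by lia.
  (* Here 2K + 1 steps from x^i e end in f and 2K steps end in e, which gives the two thresholds;
     all j chains from f have length 2K + 1. *)
  apply: (@in_PNB_swap _ l1 l2 j c (2 * k.+1).+1 (l2 - (w + k * w) - j)
    (l1 - (w + k * w)) 0 j) hsh _ _ _ _ _ _ _ _ _ _ _ _ _ _ _ _;
    try (move=> i); rewrite ?m2 ?succnK ?in_block_iter ?jc ?(mulSn (2 * _)) -?mulnA
      ?(mulSn k) /=; lia.
- move=> not_a _.
  (* The chain lengths spread over three values when some k satisfies
     l2 - l < k w < l2 - j; for the balanced split of j + l there is none. *)
  pose j' := (j + l)./2; pose l' := uphalf (j + l); pose c := l1 - l2 + l'.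
  have j'l' : j' + l' = j + l by rewrite /j' /l' uphalf_half; lia.
  have le_l' : j' <= l' <= j'.+1 by rewrite /l' uphalf_half /j'; case: odd; lia.
  have jc : j' + c = w by rewrite /w /c; lia.
  (* This is the largest k with k w < l1, so l1 <= (k + 1) w; failure of (a) at this k then gives k
     w < l2. *)
  pose k := l1.-1 %/ w; have Ediv := divn_eq l1.-1 w.
  have ltK : l1.-1 %% w < w by rewrite ltn_mod.
  have lt2 : k * w < l2.
    rewrite ltnNge; apply/negP => le; apply: not_a; exists k.
    by rewrite le /=; rewrite -/k in Ediv; lia.
  rewrite -/k in Ediv.
  (* If l2 - j' <= k w, all chains have length 2k or 2k + 1; otherwise 2k + 1 or 2k + 2. In the
     second case l' <= j' + 1 gives k w <= l2 - l', so no chain has length 2k. *)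
  have [big | small] := leqP (l2 - j') (k * w).
  + have k_gt0 : 0 < k by rewrite lt0n; apply/eqP => k0; move: big; rewrite k0; lia.
    have En : l1 + l2 = 2 * k * w + (l1 + l2 - 2 * (k * w)) by rewrite -mulnA; lia.
    rewrite [X in almost_rect X]En (@almost_rect_part3 _ _ _ (2 * k).-1) -?En; try lia.
    case: (k) k_gt0 big Ediv lt2 => // k' _; rewrite mulSn => big Ediv lt2.
    have m1 : (2 * k'.+1).-1 = (2 * k').+1 by lia.
    apply: (@in_PNB_swap _ l1 l2 j' c (2 * k'.+1) (l1 - (w + k' * w)) c
      (l2 - (w + k' * w)) j') hsh _ _ _ _ _ _ _ _ _ _ _ _ _ _ _ _;
      try (move=> i); rewrite ?m1 ?succnK ?in_block_iter ?jc -?mulnA ?(mulSn k') /=; lia.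
  + have En : l1 + l2 = (2 * k).+1 * w + (l1 + l2 - w - 2 * (k * w)).
      by rewrite mulSn -mulnA; lia.
    rewrite [X in almost_rect X]En (@almost_rect_part3 _ _ _ (2 * k)) -?En; try lia.
    apply: (@in_PNB_swap _ l1 l2 j' c (2 * k).+1 (l2 - k * w - j') c
      (l2 - k * w - l') j') hsh _ _ _ _ _ _ _ _ _ _ _ _ _ _ _ _;
      try (move=> i); rewrite ?succnK ?in_block_iter ?jc ?(mulSn (2 * _)) -?mulnA /=; lia.
Qed.
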